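(* Consider the Abelian heap $(\mathbb{Z},[-,-,-]_+)$ with $[l,m,n]_+=l-m+n$, and let $$\mathcal{I}_2(\mathbb{Z})=\{\mathbf{p}\in M_2(\mathbb{Z})\mid \mathbf{p}^2=\mathbf{p},\ \mathrm{tr}(\mathbf{p})=1\}.$$ (1) There are two non-commutative truss structures on $(\mathbb{Z},[-,-,-]_+)$, with products defined, for all $m,n\in\mathbb{Z}$, by $$m\cdot n=m\quad\text{or}\quad m\cdot n=n.$$ (2) Commutative truss structures on $(\mathbb{Z},[-,-,-]_+)$ are in one-to-one correspondence with elements of $\mathcal{I}_2(\mathbb{Z})$. (3) Let $$D_\infty=\left\{\begin{pmatrix}1&0\\k&\pm1\end{pmatrix}\;\Big|\;k\in\mathbb{Z}\right\}$$ be an infinite dihedral subgroup of $GL_2(\mathbb{Z})$. Isomorphism classes of commutative truss structures on $(\mathbb{Z},[-,-,-]_+)$ are in one-to-one correspondence with orbits of the action of $D_\infty$ on $\mathcal{I}_2(\mathbb{Z})$.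
   Context: A heap is a non-empty set $H$ with a ternary operation $[-,-,-]$ satisfying $[v,w,[x,y,z]]=[[v,w,x],y,z]$ and $[x,x,y]=y=[y,x,x]$; it is Abelian if $[x,y,z]=[z,y,x]$. A heap morphism is a function preserving the ternary operations. A truss structure on an Abelian heap $(T,[-,-,-])$ is an associative binary operation $\cdot$ on $T$ (with no identity element assumed, and written as juxtaposition below) such that $w[x,y,z]=[wx,wy,wz]$ and $[x,y,z]w=[xw,yw,zw]$ for all $w,x,y,z\in T$. It is commutative if $\cdot$ is commutative. A morphism of trusses is a function that is both a heap morphism and a semigroup morphism; an isomorphism is a bijective morphism. $M_2(\mathbb{Z})$ is the set of two-by-two matrices with integer entries and $GL_2(\mathbb{Z})$ is the group of invertible matrices in it. $GL_2(\mathbb{Z})$, and hence its subgroup $D_\infty$, acts on $\mathcal{I}_2(\mathbb{Z})$ by conjugation, $\mathbf{a}\triangleright\mathbf{p}=\mathbf{a}\mathbf{p}\mathbf{a}^{-1}$. *)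

(* Defs.v *)
From mathcomp Require Import all_boot all_order all_algebra.
From mathcomp Require Import boolp classical_sets functions.
From mathcomp Require Import ring.
Set Implicit Arguments.
Unset Strict Implicit.
Unset Printing Implicit Defensive.
Import Order.TTheory GRing.Theory Num.Theory.
Local Open Scope classical_set_scope.
Local Open Scope ring_scope.

Definition is_heap (T : Type) (br : T -> T -> T -> T) : Prop :=
  [/\ inhabited T,
      forall v w x y z, br v w (br x y z) = br (br v w x) y z,
      forall x y, br x x y = y
    & forall x y, br y x x = y].

Definition is_abelian_heap (T : Type) (br : T -> T -> T -> T) : Prop :=
  is_heap br /\ forall x y z, br x y z = br z y x.

Definition heap_morphism (T S : Type) (brT : T -> T -> T -> T)
    (brS : S -> S -> S -> S) (f : T -> S) : Prop :=
  forall x y z, f (brT x y z) = brS (f x) (f y) (f z).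

Definition semigroup_morphism (T S : Type) (muT : T -> T -> T)
    (muS : S -> S -> S) (f : T -> S) : Prop :=
  forall x y, f (muT x y) = muS (f x) (f y).

Definition is_truss (T : Type) (br : T -> T -> T -> T) (mu : T -> T -> T)
    : Prop :=
  [/\ is_abelian_heap br,
      associative mu,
      forall w x y z, mu w (br x y z) = br (mu w x) (mu w y) (mu w z)
    & forall w x y z, mu (br x y z) w = br (mu x w) (mu y w) (mu z w)].

Definition truss_morphism (T S : Type)
    (brT : T -> T -> T -> T) (muT : T -> T -> T)
    (brS : S -> S -> S -> S) (muS : S -> S -> S) (f : T -> S) : Prop :=
  heap_morphism brT brS f /\ semigroup_morphism muT muS f.

Definition truss_isomorphic (T S : Type)
    (brT : T -> T -> T -> T) (muT : T -> T -> T)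
    (brS : S -> S -> S -> S) (muS : S -> S -> S) : Prop :=
  exists2 f : T -> S, truss_morphism brT muT brS muS f & bijective f.

Definition int_br (l m n : int) : int := l - m + n.

Lemma int_br_abelian_heap : is_abelian_heap int_br.
Proof.
rewrite /int_br; split; last by move=> *; ring.
by split; [exact: (inhabits 0) | move=> * ..]; ring.
Qed.

Definition noncommutative_int_trusses : set (int -> int -> int) :=
  [set mu | is_truss int_br mu /\ ~ commutative mu].

Definition commutative_int_trusses : set (int -> int -> int) :=
  [set mu | is_truss int_br mu /\ commutative mu].

Definition iso_class (mu : int -> int -> int) : set (int -> int -> int) :=
  [set nu | commutative_int_trusses nu /\
            truss_isomorphic int_br mu int_br nu].

Definition iso_classes : set (set (int -> int -> int)) :=
  [set iso_class mu | mu in commutative_int_trusses].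

Definition I2 : set 'M[int]_2 := [set p | p *m p = p /\ \tr p = 1].

Definition mx2 (a b c d : int) : 'M[int]_2 :=
  \matrix_(i, j) if i == 0 then (if j == 0 then a else b)
                 else (if j == 0 then c else d).

Definition Dinf_mx (k : int) (s : bool) : 'M[int]_2 :=
  mx2 1 0 k ((-1) ^+ s).

Definition Dinf : set 'M[int]_2 := [set a | exists k s, a = Dinf_mx k s].

(* [invmx a] is the inverse of [a] only for [a \in unitmx]; this covers all
   of [Dinf], see [Dinf_unitmx]. *)
Definition conj_act (a p : 'M[int]_2) : 'M[int]_2 := a *m p *m invmx a.

Definition Dinf_orbit (p : 'M[int]_2) : set 'M[int]_2 :=
  [set conj_act a p | a in Dinf].

Definition Dinf_orbits : set (set 'M[int]_2) :=
  [set Dinf_orbit p | p in I2].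

(* For p = (beta, alpha; - gamma, 1 - beta), this is the operation
   alpha m n + beta (m + n) + gamma. It is associative exactly when
   beta ^ 2 - beta = alpha gamma, that is, when \det p = 0; for a matrix of
   trace 1 this says that p is idempotent. *)
Definition mx_product (p : 'M[int]_2) (m n : int) : int :=
  p 0 1 * (m * n) + p 0 0 * (m + n) - p 1 0.

(* The multiplication law of the semidirect product of Z by {1, -1} acting by
   sign, i.e. of the infinite dihedral group. *)
Lemma Dinf_mxM k s l t :
  Dinf_mx k s *m Dinf_mx l t = Dinf_mx (k + (-1) ^+ s * l) (s (+) t).
Proof.
apply/matrixP => i j; rewrite !mxE !big_ord_recl big_ord0 !mxE /= signr_addb.
by case: i => [[|[|//]] hi]; case: j => [[|[|//]] hj] /=; ring.
Qed.

Lemma Dinf_mx_inj k s l t : Dinf_mx k s = Dinf_mx l t -> k = l /\ s = t.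
Proof.
move=> /matrixP e; have := e 1 0; have := e 1 1; rewrite !mxE /=.
by move=> + ->; case: s {e}; case: t.
Qed.

Lemma Dinf_mx1 : Dinf_mx 0 false = 1%:M.
Proof.
apply/matrixP => i j; rewrite !mxE.
by case: i => [[|[|//]] hi]; case: j => [[|[|//]] hj].
Qed.

Lemma Dinf_mxV k s :
  Dinf_mx k s *m Dinf_mx (- ((-1) ^+ s * k)) s = 1%:M.
Proof.
by rewrite Dinf_mxM addbb -Dinf_mx1 mulrN mulrA -expr2 sqrr_sign mul1r subrr.
Qed.

Lemma Dinf_unitmx a : Dinf a -> a \in unitmx.
Proof. by move=> [k [s ->]]; case: (mulmx1_unit (Dinf_mxV k s)). Qed.

Lemma Dinf1 : Dinf 1%:M.
Proof. by exists 0, false; rewrite Dinf_mx1. Qed.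

Lemma DinfM a b : Dinf a -> Dinf b -> Dinf (a *m b).
Proof.
move=> [k [s ->]] [l [t ->]]; rewrite Dinf_mxM.
by exists (k + (-1) ^+ s * l), (s (+) t).
Qed.

Lemma DinfV a : Dinf a -> Dinf (invmx a).
Proof.
move=> Da; have Ua := Dinf_unitmx Da; case: Da => k [s ea].
exists (- ((-1) ^+ s * k)), s.
by rewrite -[RHS](mulKmx Ua) {3}ea Dinf_mxV mulmx1.
Qed.

Lemma conj_act_I2 a p : a \in unitmx -> I2 p -> I2 (conj_act a p).
Proof.
move=> Ua [pp tp]; split; rewrite /conj_act.
  by rewrite !mulmxA mulmxKV // -(mulmxA a p p) pp.
by rewrite mxtrace_mulC !mulmxA mulVmx // mul1mx.
Qed.

(* Main.v *)
Require Import Defs.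
From mathcomp Require Import all_boot all_order all_algebra.
From mathcomp Require Import boolp classical_sets functions.
From mathcomp Require Import ring zify.
Set Implicit Arguments.
Unset Strict Implicit.
Unset Printing Implicit Defensive.
Import Order.TTheory GRing.Theory Num.Theory.
Local Open Scope classical_set_scope.
Local Open Scope ring_scope.

(* A map of Z that preserves l - m + n is affine, so a truss product is
   biaffine, a m n + b m + c n + d, and associativity amounts to
   a b = a c, b d = c d, b^2 = a d + b and c^2 = a d + c.  If b <> c, then
   a = d = 0 and {b, c} = {0, 1}.  If b = c, the remaining equation
   b^2 - b = a d says that the trace-one matrix (b, a; - d, 1 - b) is
   idempotent.  An isomorphism is an invertible affine map n |-> k +- n, and
   transporting a product along it conjugates its matrix by (1, 0; k, +-1). *)

Lemma heap_morphism_affine (f : int -> int) :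
  heap_morphism int_br int_br f -> forall n, f n = f 0 + (f 1 - f 0) * n.
Proof.
move=> fH.
(* The sum [x + y] is the heap operation applied to [x], [0], [y], so [f] is additive up to the
   constant [f 0]. *)
have fD x y : f (x + y) = f x + f y - f 0.
  by rewrite -{1}(subr0 x) fH /int_br; ring.
elim/int_ind => [|n IH|n IH]; first by ring.
  by rewrite -addn1 PoszD fD IH; ring.
have := fD (- n.+1%:Z) 1.
have -> : - n.+1%:Z + 1 = - n%:Z by lia.
move=> e; have {e} -> : f (- n.+1%:Z) = f (- n%:Z) - f 1 + f 0 by rewrite e; ring.
by rewrite IH -addn1 PoszD; ring.
Qed.

(** The preimage of [u + 1] is an inverse of [v], and the units of the integers are the signs. *)
Lemma affine_bijective_sign (u v : int) :
  bijective (fun n => u + v * n) -> exists s : bool, v = (-1) ^+ s.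
Proof.
case=> g _ fK; have := fK (u + 1); rewrite mulrC => /addrI vV.
have /orP[/eqP ->|/eqP ->] := intUnitRing.unitzPl vV.
  by exists false.
by exists true.
Qed.

(** * Biaffine products on the integers and the non-commutative case *)

Definition biaffine (a b c d m n : int) : int := a * (m * n) + b * m + c * n + d.

(** The associator of [x], [y], [z] is a combination of [x * z], [x], [z] and [1], free of [y]. Up
    to sign its coefficients are the differences of the sides of the four equations, so the triples
    with [y = 0] and [x], [z] in {0, 1} recover them. *)
Lemma biaffine_associative (a b c d : int) :
  associative (biaffine a b c d) <->
  [/\ a * b = a * c, b * d = c * d, b ^+ 2 = a * d + b & c ^+ 2 = a * d + c].
Proof.
split=> [assoc|[ab bd bb cc] x y z]; last first.
  apply/eqP; rewrite -subr_eq0; apply/eqP; rewrite /biaffine.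
  transitivity ((a * c - a * b) * (x * z) - (b * d - c * d)
     - (b ^+ 2 - (a * d + b)) * x + (c ^+ 2 - (a * d + c)) * z); first by ring.
  by rewrite ab bd bb cc; ring.
have h0 := assoc 0 0 0; have h1 := assoc 1 0 0.
have h2 := assoc 0 0 1; have h3 := assoc 1 0 1.
by rewrite /biaffine in h0 h1 h2 h3; split; lia.
Qed.

Lemma biaffine_is_truss (a b c d : int) :
  [/\ a * b = a * c, b * d = c * d, b ^+ 2 = a * d + b & c ^+ 2 = a * d + c] ->
  is_truss int_br (biaffine a b c d).
Proof.
move=> /biaffine_associative assoc; split=> //; first exact: int_br_abelian_heap.
  by move=> *; rewrite /int_br /biaffine; ring.
by move=> *; rewrite /int_br /biaffine; ring.
Qed.

(** Distributivity makes [mu] a heap morphism in each variable. Expanding it in the second variable,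
    and then in the first at the values 0 and 1 of the second, leaves only finite differences as
    coefficients. *)
Lemma int_truss_biaffine (mu : int -> int -> int) : is_truss int_br mu ->
  mu = biaffine (mu 1 1 - mu 1 0 - mu 0 1 + mu 0 0)
                (mu 1 0 - mu 0 0) (mu 0 1 - mu 0 0) (mu 0 0).
Proof.
move=> [_ _ distl distr]; apply/funext => m; apply/funext => n.
rewrite (heap_morphism_affine (distl m)).
rewrite (heap_morphism_affine (distr 0)) (heap_morphism_affine (distr 1)).
by rewrite /biaffine; ring.
Qed.

Lemma int_truss_coefficients (mu : int -> int -> int) : is_truss int_br mu ->
  exists a b c d, mu = biaffine a b c d /\
  [/\ a * b = a * c, b * d = c * d, b ^+ 2 = a * d + b & c ^+ 2 = a * d + c].
Proof.
move=> muT; have e := int_truss_biaffine muT; case: muT => _.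
rewrite {1}e => /biaffine_associative coef _ _.
by do 4!eexists; split; [exact: e|exact: coef].
Qed.

Lemma biaffine_commutative (a b c d : int) :
  commutative (biaffine a b c d) <-> b = c.
Proof.
split=> [/(_ 1 0)|-> x y]; rewrite /biaffine; last by ring.
by rewrite !(mulr0, mul0r, mulr1, addr0, add0r) => /addIr.
Qed.

Lemma noncommutative_int_trussesE : noncommutative_int_trusses
  = [set (fun m n : int => m); (fun m n : int => n)].
Proof.
have proj1E : (fun m n : int => m) = biaffine 0 1 0 0.
  by apply/funext => m; apply/funext => n; rewrite /biaffine; ring.
have proj2E : (fun m n : int => n) = biaffine 0 0 1 0.
  by apply/funext => m; apply/funext => n; rewrite /biaffine; ring.
rewrite proj1E proj2E; apply/seteqP; split=> mu.
  move=> [/int_truss_coefficients[a [b [c [d [-> [ab bd bb cc]]]]]] ncomm].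
  have {ncomm} /eqP bc : b <> c by move=> /biaffine_commutative.
  (* The nonzero factor [b - c] cancels in [ab] and [bd]; then [b] and [c] become distinct
     idempotent integers. *)
  have a0 : a = 0 by nia.
  have d0 : d = 0 by nia.
  rewrite a0 d0 in bb cc *.
  have [[-> ->]|[-> ->]] : (b = 1 /\ c = 0) \/ (b = 0 /\ c = 1) by nia.
    by left.
  by right.
by case=> ->; (split; [apply: biaffine_is_truss; split; ring|]);
  move=> /biaffine_commutative.
Qed.

(** * Trace-one idempotents and commutative products *)

Lemma mx2_eq (p q : 'M[int]_2) :
  p 0 0 = q 0 0 -> p 0 1 = q 0 1 -> p 1 0 = q 1 0 -> p 1 1 = q 1 1 -> p = q.
Proof.
move=> e00 e01 e10 e11; apply/matrixP => i j.
have cases (l : 'I_2) : l = 0 \/ l = 1.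
  by case: l => [[|[|//]] hl]; [left|right]; apply/val_inj.
by case: (cases i) => ->; case: (cases j) => ->.
Qed.

Lemma mulmx2E (p q : 'M[int]_2) i j : (p *m q) i j = p i 0 * q 0 j + p i 1 * q 1 j.
Proof.
rewrite mxE !big_ord_recl big_ord0 addr0.
by congr (_ + p i _ * q _ j); apply/val_inj.
Qed.

(** For trace one, the off-diagonal entries of [p *m p = p] hold automatically and both diagonal
    entries say that the determinant vanishes, so one scalar equation remains. *)
Lemma I2P (p : 'M[int]_2) :
  I2 p <-> p 1 1 = 1 - p 0 0 /\ p 0 0 ^+ 2 + p 0 1 * p 1 0 = p 0 0.
Proof.
have trE : \tr p = p 0 0 + p 1 1.
  rewrite /mxtrace !big_ord_recl big_ord0 addr0.
  by congr (_ + p _ _); apply/val_inj.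
split=> [[idem]|[p11 det0]].
  rewrite trE => tr1; split; first by rewrite -tr1; ring.
  by rewrite -{4}idem mulmx2E expr2.
split; last by rewrite trE p11; ring.
have {det0} e : p 0 1 * p 1 0 = p 0 0 - p 0 0 ^+ 2 by rewrite -{1}det0; ring.
apply: mx2_eq; rewrite mulmx2E ?p11; try ring.
  by rewrite e; ring.
by rewrite (mulrC (p 1 0)) e; ring.
Qed.

Lemma mx_product_biaffine (p : 'M[int]_2) :
  mx_product p = biaffine (p 0 1) (p 0 0) (p 0 0) (- p 1 0).
Proof.
by apply/funext => m; apply/funext => n; rewrite /mx_product /biaffine; ring.
Qed.

Lemma mx_product_truss (p : 'M[int]_2) :
  I2 p -> commutative_int_trusses (mx_product p).
Proof.
move=> /I2P[_ det0]; rewrite mx_product_biaffine; split; last first.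
  exact/biaffine_commutative.
by apply: biaffine_is_truss; split=> //; rewrite -{2}det0; ring.
Qed.

(** The inverse of [mx_product] on commutative trusses: finite differences at 0 and 1 read off the
    coefficients, and the last entry is forced by trace one. *)
Definition truss_mx (mu : int -> int -> int) : 'M[int]_2 :=
  mx2 (mu 1 0 - mu 0 0) (mu 1 1 - mu 1 0 - mu 0 1 + mu 0 0)
      (- mu 0 0) (1 - (mu 1 0 - mu 0 0)).

Lemma mx_productK (p : 'M[int]_2) : I2 p -> truss_mx (mx_product p) = p.
Proof.
by move=> /I2P[p11 _]; apply: mx2_eq; rewrite mxE /= ?p11 /mx_product; ring.
Qed.

Lemma truss_mxK (mu : int -> int -> int) :
  commutative_int_trusses mu -> mx_product (truss_mx mu) = mu.
Proof.
move=> [/int_truss_biaffine muE comm]; rewrite [RHS]muE mx_product_biaffine.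
by rewrite !mxE /= (comm 0 1) opprK.
Qed.

Lemma truss_mx_I2 (mu : int -> int -> int) :
  commutative_int_trusses mu -> I2 (truss_mx mu).
Proof.
move=> [/int_truss_coefficients[a [b [c [d [-> [_ _ bb _]]]]]]].
move=> /biaffine_commutative <-; apply/I2P; rewrite !mxE /= /biaffine.
split; first by ring.
by apply/eqP; rewrite -subr_eq0; apply/eqP; transitivity (b ^+ 2 - (a * d + b));
  [ring|rewrite bb; ring].
Qed.

Lemma truss_mx_bij : set_bij commutative_int_trusses I2 truss_mx.
Proof.
split; first by move=> mu; exact: truss_mx_I2.
  move=> mu nu; rewrite !inE => /truss_mxK muE /truss_mxK nuE e.
  by rewrite -muE -nuE e.
by move=> p Ip; exists (mx_product p); [exact: mx_product_truss|exact: mx_productK].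
Qed.

(** * Conjugation, isomorphisms and orbits *)

Lemma conj_act_eq (a p q : 'M[int]_2) : a \in unitmx ->
  conj_act a p = q <-> a *m p = q *m a.
Proof.
move=> Ua; rewrite /conj_act; split=> [<-|->]; first by rewrite mulmxKV.
by rewrite mulmxK.
Qed.

(** Write the conjugation as [a *m p = q *m a]. Its entries (0,1) and (0,0) match the coefficients
    of [m * n] and [m + n] in the morphism equation; given these, entry (1,0) matches the constant
    term and entry (1,1) follows. *)
Lemma conj_act_morphism (k : int) (s : bool) (p q : 'M[int]_2) : I2 p -> I2 q ->
  conj_act (Dinf_mx k s) p = q <->
  semigroup_morphism (mx_product p) (mx_product q) (fun n => k + (-1) ^+ s * n).
Proof.
move=> /I2P[p11 _] /I2P[q11 _].
rewrite conj_act_eq; last by apply: Dinf_unitmx; exists k, s.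
rewrite /semigroup_morphism /mx_product.
split=> [e m n|h].
  have := congr1 (fun x : 'M_2 => x 0 0) e; have := congr1 (fun x : 'M_2 => x 0 1) e.
  have := congr1 (fun x : 'M_2 => x 1 0) e.
  rewrite !mulmx2E !mxE /= ?p11 ?q11.
  by case: s {e} => /=; rewrite ?expr0 ?expr1 => e10 e01 e00; nia.
(* Both sides are symmetric and biaffine in [m], [n], so these three values determine all
   coefficients. *)
have h00 := h 0 0; have h10 := h 1 0; have h11 := h 1 1.
by apply: mx2_eq; rewrite !mulmx2E !mxE /= ?p11 ?q11;
  case: s h00 h10 h11 {h} => /=; rewrite ?expr0 ?expr1; nia.
Qed.

Lemma truss_isomorphic_orbit (mu nu : int -> int -> int) :
  commutative_int_trusses mu -> commutative_int_trusses nu ->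
  truss_isomorphic int_br mu int_br nu <->
  Dinf_orbit (truss_mx mu) (truss_mx nu).
Proof.
move=> muC nuC; have Imu := truss_mx_I2 muC; have Inu := truss_mx_I2 nuC.
split=> [[f [fH fM] fbij]|[_ [k [s ->]]]].
  have fE : f = fun n => f 0 + (f 1 - f 0) * n.
    by apply/funext => n; exact: heap_morphism_affine.
  have [s sE] : exists s : bool, f 1 - f 0 = (-1) ^+ s.
    by apply: (@affine_bijective_sign (f 0)); rewrite -fE.
  exists (Dinf_mx (f 0) s); first by exists (f 0), s.
  by apply/conj_act_morphism => //; rewrite !truss_mxK // -sE -fE.
move=> /(conj_act_morphism _ _ Imu Inu); rewrite !truss_mxK // => fM.
exists (fun n => k + (-1) ^+ s * n).
  by split=> // x y z; rewrite /int_br; ring.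
by exists (fun n => (-1) ^+ s * (n - k)) => n;
  rewrite ?(addrC k) ?addrK signrMK ?subrK.
Qed.

(** In this form the class depends on [mu] only through the orbit of its matrix, which yields
    injectivity on classes. *)
Lemma iso_classE (mu : int -> int -> int) : commutative_int_trusses mu ->
  iso_class mu
    = commutative_int_trusses `&` truss_mx @^-1` Dinf_orbit (truss_mx mu).
Proof.
move=> muC; apply/seteqP; split=> nu [nuC].
  by move=> /(truss_isomorphic_orbit muC nuC).
by move=> o; split=> //; exact/truss_isomorphic_orbit.
Qed.

Lemma image_iso_class (mu : int -> int -> int) : commutative_int_trusses mu ->
  truss_mx @` iso_class mu = Dinf_orbit (truss_mx mu).
Proof.
move=> muC; rewrite iso_classE //; apply/seteqP; split=> [_ [nu [_ o] <-] //|q o].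
(* Conjugation preserves [I2], so every point of the orbit is the matrix of some commutative
   truss. *)
have Iq : I2 q.
  by case: o => a /Dinf_unitmx Ua <-; exact/conj_act_I2/truss_mx_I2.
have [_ _ /(_ q Iq)[nu nuC nuE]] := truss_mx_bij.
by exists nu => //; split=> //; rewrite /preimage /= nuE.
Qed.

(** Taking direct images defines the map on classes without choosing representatives. *)
Lemma image_iso_class_bij :
  set_bij iso_classes Dinf_orbits (fun C => truss_mx @` C).
Proof.
split.
- move=> _ [mu muC <-]; exists (truss_mx mu); first exact: truss_mx_I2.
  by rewrite image_iso_class.
- move=> C D; rewrite !inE => -[mu muC <-] [nu nuC <-].
  by rewrite !image_iso_class // !iso_classE // => ->.
- move=> _ [p Ip <-]; have [_ _ /(_ p Ip)[mu muC <-]] := truss_mx_bij.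
  by exists (iso_class mu); [exists mu|exact: image_iso_class].
Qed.

Theorem theorem3p51 :
  (noncommutative_int_trusses
     = [set (fun m n : int => m); (fun m n : int => n)]
   /\ (fun m n : int => m) <> (fun m n : int => n))
  /\
  exists Phi : (int -> int -> int) -> 'M[int]_2,
    [/\ set_bij commutative_int_trusses I2 Phi,
        forall mu, commutative_int_trusses mu ->
          forall m n : int, mu m n = mx_product (Phi mu) m n
      & exists Psi : set (int -> int -> int) -> set 'M[int]_2,
          set_bij iso_classes Dinf_orbits Psi
          /\ forall mu, commutative_int_trusses mu ->
               Psi (iso_class mu) = Dinf_orbit (Phi mu)].
Proof.
split.
  split; first exact: noncommutative_int_trussesE.
  by move=> /(congr1 (fun f => f 0 1)).
exists truss_mx; split; first exact: truss_mx_bij.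
  by move=> mu muC m n; rewrite truss_mxK.
exists (fun C => truss_mx @` C); split; first exact: image_iso_class_bij.
exact: image_iso_class.
Qed.
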